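(* Let $a_1,a_2$ be integers with $a_2\ne 0$ and $\gcd(a_1,a_2)=1$, and let $\{u_n\}_{n\ge0}$ be the Lucas sequence defined by $u_0=0$, $u_1=1$, $u_{n+2}=a_1u_{n+1}+a_2u_n$. Assume the roots $\alpha_1,\alpha_2$ of $X^2-a_1X-a_2$ are distinct and $\alpha_1/\alpha_2$ is not a root of unity. Then $$\#\{n\le x:\ n\mid u_n\}\le \frac{x}{L(x)^{1+o(1)}}\qquad\text{as }x\to\infty,$$ where $L(x)=\exp\left(\sqrt{\log x\,\log\log x}\right)$.
   Context: In the definition of $L(x)$, logarithms are truncated so as to be at least $1$: $\log x$ means $\max\{\log x,1\}$ and $\log\log x$ means $\max\{\log(\max\{\log x,1\}),1\}$. *)

(* Defs.v *)
From mathcomp Require Import all_boot all_order all_algebra all_field.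
From mathcomp Require Import all_classical all_reals all_analysis.
Import Order.TTheory GRing.Theory Num.Theory.
Import numFieldNormedType.Exports.

Set Implicit Arguments.
Unset Strict Implicit.
Unset Printing Implicit Defensive.

Local Open Scope ring_scope.

Fixpoint lucas (a1 a2 : int) (n : nat) : int :=
  match n with
  | 0%N => 0
  | 1%N => 1
  | (n1.+1 as m).+1 => a1 * lucas a1 a2 m + a2 * lucas a1 a2 n1
  end.

Definition lucas_charpoly (a1 a2 : int) : {poly algC} :=
  'X^2 - a1%:~R *: 'X - (a2%:~R)%:P.

(* The index n = 0, for which 0 %| lucas a1 a2 0 holds, is not counted. *)
Definition count_dvd_lucas (R : realType) (a1 a2 : int) (x : R) : nat :=
  (\sum_(1 <= n < (Num.truncn x).+1 | (n%:Z %| lucas a1 a2 n)%Z) 1)%N.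

Definition log_trunc (R : realType) (x : R) : R := Num.max (ln x) 1.

Definition L (R : realType) (x : R) : R :=
  expR (Num.sqrt (log_trunc x * log_trunc (log_trunc x))).

(* Main.v *)
(** Write [z p] for the least [k > 0] with [p | u_k]. For large primes [z p]
    divides [p - 1] or [p + 1], so [p * z p] divides [n] whenever [p | n | u_n].
    Sort the [n <= x] by their largest prime factor [p]: the cofactor
    [n / (p * z p)] is [p]-smooth, and Rankin's trick with exponent
    [1 - delta], where [p^delta = (log x)^(1/2 - eta)], bounds the number of
    such [n] by [x / (p * z p) * exp (- (1/2 - eta) om^2 / log p)] up to a factor
    [L(x)^o(1)], with [om = log L(x)]. By AM-GM this is at most
    [x L(x)^(- (1 - 2 eta)) / (sqrt p * z p)]. Finally the sum of
    [1 / (sqrt p * z p)] is at most that of [1/p + 1/(z p)^2], which is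
    [O(log x)] because the primes with [z p = k] all divide [u_k] and so number
    [O(k)]. *)
Require Import Defs.
From mathcomp Require Import all_boot all_order all_algebra all_field.
From mathcomp Require Import all_classical all_reals all_analysis.
From mathcomp Require Import ring lra zify.
Import Order.TTheory GRing.Theory Num.Theory.
Import numFieldNormedType.Exports.

Set Implicit Arguments.
Unset Strict Implicit.
Unset Printing Implicit Defensive.

Local Open Scope classical_set_scope.
Local Open Scope ring_scope.

(** * Ranks of apparition *)

Section LucasField.
Variables (F : fieldType) (b1 b2 : F) (U : nat -> F).
Hypotheses (b2_neq0 : b2 != 0) (U0 : U 0%N = 0) (U1 : U 1%N = 1).
Hypothesis U_rec : forall n, U n.+2 = b1 * U n.+1 + b2 * U n.

Lemma lucasF_add m n : U (m + n.+1)%N = U m.+1 * U n.+1 + b2 * U m * U n.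
Proof.
suff: U (m + n.+1)%N = U m.+1 * U n.+1 + b2 * U m * U n /\
  U (m + n.+2)%N = U m.+1 * U n.+2 + b2 * U m * U n.+1 by case.
elim: n => [|n [IH1 IH2]].
  by rewrite !addnS addn0 !U_rec U0 U1; split; ring.
split=> //; rewrite addnS addnS U_rec -addnS IH2 IH1 !U_rec; ring.
Qed.

(** Two consecutive zeros would run back to index 0, since [b2] is invertible, and contradict
    [U1]. *)
Lemma lucasF_consecutive n : U n = 0 -> U n.+1 != 0.
Proof.
elim: n => [|n IH] Un0; first by rewrite U1 oner_neq0.
apply/eqP; rewrite U_rec Un0 mulr0 add0r => /eqP.
rewrite mulf_eq0 (negPf b2_neq0) /= => /eqP /IH.
by rewrite Un0 eqxx.
Qed.

Lemma lucasF_shift z n : U z = 0 -> U (z + n)%N = U z.+1 * U n.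
Proof.
case: n => [|n] Uz0; first by rewrite addn0 Uz0 U0 mulr0.
by rewrite lucasF_add Uz0 mulr0 mul0r addr0.
Qed.

(** By [lucasF_shift], U (q z + r) is a nonzero multiple of U r, so the minimality of [z] forces the
    remainder r to be 0. *)
Lemma lucasF_rank_dvd z n : (0 < z)%N -> U z = 0 ->
  (forall k, (0 < k < z)%N -> U k != 0) -> U n = 0 -> (z %| n)%N.
Proof.
move=> z_gt0 Uz0 zmin.
rewrite {1}(divn_eq n z); elim: (n %/ z)%N => [|q IH]; last first.
  rewrite mulSn -addnA lucasF_shift // => /eqP.
  by rewrite mulf_eq0 (negPf (lucasF_consecutive Uz0)) => /eqP /IH.
rewrite mul0n add0n => Ur0; rewrite /dvdn; case: posnP => // r_gt0.
by have := zmin (n %% z)%N; rewrite r_gt0 ltn_pmod // Ur0 eqxx => /(_ isT).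
Qed.

(** The companion matrix of X^2 - b1 X - b2. *)
Definition lucas_mx : 'M[F]_2 :=
  \matrix_(i < 2, j < 2) (if i == 0 then if j == 0 then b1 else b2
                          else if j == 0 then 1 else 0).

Lemma lucas_mx_exp n : (lucas_mx ^+ n.+1) 0 0 = U n.+2 /\
  (lucas_mx ^+ n.+1) 1 1 = b2 * U n.
Proof.
suff: [/\ (lucas_mx ^+ n.+1) 0 0 = U n.+2, (lucas_mx ^+ n.+1) 0 1 = b2 * U n.+1,
   (lucas_mx ^+ n.+1) 1 0 = U n.+1 & (lucas_mx ^+ n.+1) 1 1 = b2 * U n] by case.
elim: n => [|n [h00 h01 h10 h11]].
  by rewrite expr1 !mxE /= U_rec U0 U1 !mulr0 !mulr1 addr0.
rewrite [lucas_mx ^+ _]exprSr.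
split; rewrite mxE big_ord_recl big_ord1 (_ : lift ord0 ord0 = 1) ?h00 ?h01
  ?h10 ?h11 ?[X in _ * X + _]mxE ?[X in _ + _ * X]mxE /= ?U_rec; try ring; exact/val_inj.
Qed.

(* The law of apparition: [(2 M - b1)^2] is the discriminant, so Frobenius
   gives [M^p = M] or [M^p = b1 - M]. *)
Lemma lucasF_apparition p : p \in [pchar F] -> odd p ->
  (forall x : F, x ^+ p = x) -> b1 ^+ 2 + 4 * b2 != 0 ->
  U p.-1 = 0 \/ U p.+1 = 0.
Proof.
move=> pF p_odd frobF D_neq0.
set M := lucas_mx; set D := b1 ^+ 2 + 4 * b2 in D_neq0.
have pM : p \in [pchar 'M[F]_2] by rewrite pchar_lalg.
have p_gt0 : (0 < p)%N by case: (p) p_odd.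
have two_neq0 : (2 : F) != 0.
  rewrite -(dvdn_pcharf pF) dvdn_prime2 //; last exact: (pcharf_prime pF).
  by apply: contraTneq p_odd => ->.
pose N : 'M[F]_2 := 2 *: M - b1%:M.
have N2 : N ^+ 2 = D%:M.
  apply/matrixP => i j; rewrite expr2 mxE big_ord_recl big_ord1 /N /D !mxE /=.
  case: i => [[|[|//]] ?]; case: j => [[|[|//]] ?]; rewrite /= ?mulr1n ?mulr0n; ring.
pose e := D ^+ p.-1./2.
have p2 : p = (p.-1./2 * 2).+1 by rewrite muln2; lia.
have Np : N ^+ p = e *: N.
  rewrite {1}p2 exprSr mulnC exprM N2 -rmorphXn -/e.
  by rewrite -mulmxE mul_scalar_mx.
have e2 : e ^+ 2 = 1.
  by apply: (mulfI D_neq0); rewrite mulr1 -exprM -exprS -p2 frobF.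
have Mp : 2 *: M ^+ p = e *: N + b1%:M.
  rewrite -Np -{1}(frobF 2) -exprZn.
  have -> : 2 *: M = N + b1%:M by rewrite /N subrK.
  rewrite -[LHS](pFrobenius_autE pM) pFrobenius_autD_comm ?pFrobenius_autE //.
    by rewrite -rmorphXn /= frobF.
  by rewrite /GRing.comm -!mulmxE mul_scalar_mx mul_mx_scalar.
have [P1 P2] := lucas_mx_exp p.-1; rewrite prednK // in P1 P2.
have half (x y : F) : 2 * x = 2 * y -> x = y by move/(mulfI two_neq0).
(* If e = 1 then M^p = M, whose lower right entry gives b2 * U p.-1 = 0. If e = -1 then M^p = b1 -
   M, whose upper left entry gives U p.+1 = 0. *)
move/eqP: e2; rewrite sqrf_eq1 => /orP[] /eqP e1.
- left; apply: (mulfI b2_neq0); rewrite mulr0 -P2; apply: half.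
  move/matrixP/(_ 1 1): Mp; rewrite e1 /N !mxE /= => ->; ring.
- right; rewrite -P1; apply: half.
  by move/matrixP/(_ 0 0): Mp; rewrite e1 /N !mxE /= => ->; ring.
Qed.
End LucasField.


Lemma dvdz_Fp p (m : int) : prime p -> (p %| m)%Z = (m%:~R == 0 :> 'F_p).
Proof. by move=> p_pr; rewrite (dvdz_pcharf (pchar_Fp p_pr)). Qed.

(** The rank [z] is the least positive index at which the sequence vanishes in ['F_p]. It divides p
    - 1 or p + 1, hence is prime to p as p > 2, so divisibility by p and by [z] combine. *)
Lemma lucas_rank (a1 a2 : int) p : prime p -> (2 < p)%N ->
  ~~ (p %| a2)%Z -> ~~ (p %| a1 ^+ 2 + 4 * a2)%Z ->
  exists z : nat, [/\ (0 < z <= p.+1)%N, (p %| lucas a1 a2 z)%Z &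
    forall n, (p %| lucas a1 a2 n)%Z -> (p %| n)%N -> (p * z %| n)%N].
Proof.
move=> p_pr p_gt2 pNa2 pND.
have pF : p \in [pchar 'F_p] by rewrite pchar_Fp.
pose U n : 'F_p := (lucas a1 a2 n)%:~R.
have dvdU n : (p %| lucas a1 a2 n)%Z = (U n == 0) by rewrite dvdz_Fp.
have U_rec n : U n.+2 = a1%:~R * U n.+1 + a2%:~R * U n.
  by rewrite /U /= rmorphD !rmorphM.
have b2_neq0 : a2%:~R != 0 :> 'F_p by rewrite -dvdz_Fp.
have U0 : U 0%N = 0 by [].
have U1 : U 1%N = 1 by [].
have Upm : U p.-1 = 0 \/ U p.+1 = 0.
  apply: (lucasF_apparition b2_neq0 U0 U1 U_rec pF).
  - by case: (even_prime p_pr) p_gt2 => [->|].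
  - by move=> x; rewrite -[X in _ ^+ X](card_Fp p_pr) expf_card.
  - by move: pND; rewrite dvdz_Fp // rmorphD rmorphXn rmorphM.
have exU : exists k, (0 < k)%N && (U k == 0).
  by case: Upm => Up; [exists p.-1|exists p.+1]; rewrite Up eqxx andbT // -subn1 subn_gt0; lia.
case: (ex_minnP exU) => z /andP[z_gt0 /eqP Uz0] zmin.
have z_dvd n : U n = 0 -> (z %| n)%N.
  apply: (lucasF_rank_dvd b2_neq0 U0 U1 U_rec z_gt0 Uz0) => k /andP[k_gt0 k_lt].
  by apply/negP => Uk; have := zmin k; rewrite k_gt0 Uk leqNgt k_lt => /(_ isT).
exists z; split; first rewrite z_gt0 /=.
- case: Upm => /z_dvd /dvdn_leq zl; last exact: zl.
  by apply: leq_trans (zl _) _; lia.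
- by rewrite dvdU Uz0.
- move=> n; rewrite dvdU => /eqP /z_dvd zn pn; rewrite Gauss_dvd ?pn //.
  rewrite prime_coprime //; apply/negP => pz.
  have p_gt0 : (0 < p)%N by lia.
  case: Upm => /z_dvd /(dvdn_trans pz) pd.
    by move/(dvdn_leq _): pd; lia.
  by move: pd; rewrite -addn1 dvdn_addr // dvdn1; lia.
Qed.

(** * The number of primes dividing a given Lucas number *)

Lemma dvdn_prod_primes (s : seq nat) M : uniq s ->
  all (fun p => prime p && (p %| M)%N) s -> (\prod_(p <- s) p %| M)%N.
Proof.
elim: s => [|p s IH] /=; first by rewrite big_nil dvd1n.
move=> /andP[ps us] /andP[/andP[p_pr pM] /[dup] sM /(IH us) sdvd].
rewrite big_cons Gauss_dvd ?pM // big_seq.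
elim/big_ind: _ => [|x y|q qs]; first exact: coprimen1.
  by rewrite coprimeMr => -> ->.
have /andP[q_pr _] := allP sM q qs.
by rewrite prime_coprime // dvdn_prime2 //; apply: contraNneq ps => ->.
Qed.

Lemma leq_exp_size_prod c (s : seq nat) :
  all (leq c) s -> (c ^ size s <= \prod_(p <- s) p)%N.
Proof.
elim: s => [|p s IH] /=; first by rewrite big_nil.
by move=> /andP[cp /IH]; rewrite big_cons expnS; exact: leq_mul.
Qed.

Section LucasSize.
Variables (a1 a2 : int) (alpha1 alpha2 : algC).
Hypothesis a2_neq0 : a2 != 0.
Hypothesis alpha_roots :
  lucas_charpoly a1 a2 = ('X - alpha1%:P) * ('X - alpha2%:P).
Hypothesis alpha_distinct : alpha1 != alpha2.

Lemma lucas_coefs : a1%:~R = alpha1 + alpha2 /\ a2%:~R = - (alpha1 * alpha2).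
Proof.
have E0 := congr1 (fun P : {poly algC} => P.[0]) alpha_roots.
have E1 := congr1 (fun P : {poly algC} => P.[1]) alpha_roots.
rewrite /= /lucas_charpoly !hornerE in E0 E1.
have h2 : a2%:~R = - (alpha1 * alpha2).
  have -> : a2%:~R = - (0 ^+ 2 - 0 - a2%:~R) :> algC by ring.
  by rewrite E0; ring.
split=> //; have -> : a1%:~R = 1 - a2%:~R - (1 ^+ 2 - a1%:~R - a2%:~R) :> algC by ring.
by rewrite E1 h2; ring.
Qed.

Lemma lucas_disc_neq0 : a1 ^+ 2 + 4 * a2 != 0.
Proof.
have [h1 h2] := lucas_coefs.
rewrite -(intr_eq0 algC) rmorphD rmorphXn rmorphM /= h1 h2.
have -> : (alpha1 + alpha2) ^+ 2 + 4%:~R * - (alpha1 * alpha2)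
  = (alpha1 - alpha2) ^+ 2 by ring.
by rewrite expf_eq0 /= subr_eq0.
Qed.

Lemma lucas_binet n :
  (alpha1 - alpha2) * (lucas a1 a2 n)%:~R = alpha1 ^+ n - alpha2 ^+ n.
Proof.
have [h1 h2] := lucas_coefs.
suff: (alpha1 - alpha2) * (lucas a1 a2 n)%:~R = alpha1 ^+ n - alpha2 ^+ n /\
   (alpha1 - alpha2) * (lucas a1 a2 n.+1)%:~R = alpha1 ^+ n.+1 - alpha2 ^+ n.+1.
  by case.
elim: n => [|n [IH1 IH2]]; first by split=> /=; ring.
split=> //.
have -> : lucas a1 a2 n.+2 = a1 * lucas a1 a2 n.+1 + a2 * lucas a1 a2 n by [].
by rewrite rmorphD !rmorphM /= mulrDr !(mulrCA (alpha1 - alpha2)) IH1 IH2 h1 h2 !exprS; ring.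
Qed.

(** By Binet's formula a zero at [n] makes the n-th powers of the two roots equal; [alpha2] is
    nonzero because a2 = - alpha1 alpha2 is. *)
Lemma lucas_neq0 n : ~~ (n.-unity_root (alpha1 / alpha2)) -> lucas a1 a2 n != 0.
Proof.
have [_ h2] := lucas_coefs.
apply: contraNneq => un0; apply/unity_rootP.
have := lucas_binet n; rewrite un0 mulr0 => /esym/eqP; rewrite subr_eq0 => /eqP E.
rewrite expr_div_n E divff // expf_neq0 //.
apply: contra_neq a2_neq0 => al0; apply/eqP.
by rewrite -(intr_eq0 algC) h2 al0 mulr0 oppr0.
Qed.

Lemma lucas_norm_le n : `|lucas a1 a2 n| <= (`|a1| + `|a2|) ^+ n.
Proof.
have B1 : 1 <= `|a1| + `|a2| by move: a2_neq0; lia.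
suff: `|lucas a1 a2 n| <= (`|a1| + `|a2|) ^+ n /\
   `|lucas a1 a2 n.+1| <= (`|a1| + `|a2|) ^+ n.+1 by case.
elim: n => [|n [IH1 IH2]]; first by rewrite expr1.
split=> //.
have -> : lucas a1 a2 n.+2 = a1 * lucas a1 a2 n.+1 + a2 * lucas a1 a2 n by [].
apply: le_trans (ler_normD _ _) _; rewrite !normrM [X in _ <= X]exprS mulrDl.
rewrite lerD ?ler_wpM2l //; apply: le_trans IH1 _.
by rewrite ler_weXn2l.
Qed.

(** The product of the primes in [s] is at least 2^(size s) and divides the nonzero u_k, whose
    absolute value is at most B^k <= 2^(B k) with B = |a1| + |a2|. *)
Lemma lucas_prime_divisors_le k (s : seq nat) : (0 < k)%N ->
  ~~ (k.-unity_root (alpha1 / alpha2)) -> uniq s ->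
  all (fun p : nat => prime p && (p %| lucas a1 a2 k)%Z) s ->
  (size s <= (`|a1| + `|a2|) * k)%N.
Proof.
move=> k_gt0 /lucas_neq0 u_neq0 us sP.
have ps_dvd := dvdn_prod_primes us (M := `|lucas a1 a2 k|%N) sP.
have le2 : (2 ^ size s <= \prod_(p <- s) p)%N.
  by apply: leq_exp_size_prod; apply: sub_all sP => p /andP[/prime_gt1].
rewrite -(leq_exp2l _ _ (ltnSn 1)).
apply: leq_trans le2 _; apply: leq_trans (dvdn_leq _ ps_dvd) _.
  by rewrite absz_gt0.
apply: leq_trans (_ : (`|a1| + `|a2|) ^ k <= _)%N.
  have := lucas_norm_le k; lia.
by rewrite expnM leq_exp2r // ltnW // ltn_expl.
Qed.
End LucasSize.

(** * Reciprocals of primes *)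

Lemma ler_sum_sub_seq (R : numDomainType) (I : eqType) (s t : seq I) (F : I -> R) :
  uniq s -> {subset s <= t} -> (forall i, 0 <= F i) ->
  \sum_(i <- s) F i <= \sum_(i <- t) F i.
Proof.
move=> us st F0; elim: s t us st => [|x s IH] t /=.
  by rewrite big_nil => _ _; exact: sumr_ge0.
move=> /andP[xs us] st.
have xt : x \in t by rewrite st ?mem_head.
rewrite big_cons (perm_big _ (perm_to_rem xt)) big_cons lerD2l; apply: IH => // y ys.
have := st y; rewrite inE ys orbT (perm_mem (perm_to_rem xt)) inE => /(_ isT).
by case/orP=> // /eqP yx; rewrite -yx ys in xs.
Qed.

(** The change of variable behind most comparisons below: [h] is the identity when a range or
    condition is enlarged, and n |-> n %/ d when multiples of d are replaced by their cofactors. *)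
Lemma ler_sum_nat_inj (R : numDomainType) (P Q : pred nat) (h : nat -> nat)
    (F : nat -> R) N M :
  (forall n, (1 <= n < N.+1)%N -> P n -> (1 <= h n < M.+1)%N && Q (h n)) ->
  (forall n m, (1 <= n < N.+1)%N -> (1 <= m < N.+1)%N -> P n -> P m ->
     h n = h m -> n = m) ->
  (forall i, 0 <= F i) ->
  \sum_(1 <= n < N.+1 | P n) F (h n) <= \sum_(1 <= m < M.+1 | Q m) F m.
Proof.
move=> hP h_inj F0; rewrite -big_filter -[leRHS]big_filter -(big_map h xpredT).
apply: ler_sum_sub_seq => //.
  rewrite map_inj_in_uniq ?filter_uniq ?iota_uniq // => n m.
  by rewrite !mem_filter !mem_index_iota => /andP[? ?] /andP[? ?]; exact: h_inj.
move=> _ /mapP[n + ->]; rewrite !mem_filter !mem_index_iota.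
by move=> /andP[Pn nN]; rewrite andbC hP.
Qed.

Section PrimeSums.

Lemma central_bin_le n : ('C(n.*2, n) <= 4 ^ n)%N.
Proof.
rewrite (_ : 4 = 2 ^ 2)%N // -expnM mul2n -[X in (X ^ _)%N]/(1 + 1)%N expnDn.
have nn : (n < (n.*2).+1)%N by rewrite ltnS -addnn leq_addr.
by rewrite (bigD1 (Ordinal nn)) //= !exp1n !muln1 leq_addr.
Qed.

Lemma prime_dvd_fact p n : prime p -> (p %| n`!)%N = (p <= n)%N.
Proof.
move=> p_pr; apply/idP/idP => [|pn]; last by rewrite dvdn_fact // prime_gt0.
elim: n => [|n IH]; first by rewrite dvdn1 => /eqP p1; rewrite p1 in p_pr.
rewrite factS Euclid_dvdM // => /orP[/dvdn_leq -> //|/IH pn].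
exact: leqW.
Qed.

(** Chebyshev's argument: with n = 2^j, the primes in (n, 2n] all divide C(2n, n) <= 4^n = 2^(2n),
    and each of them exceeds 2^j. *)
Lemma size_primes_dyadic j :
  (j * size [seq q <- index_iota (2 ^ j).+1 (2 ^ j.+1).+1 | prime q]
   <= 2 ^ j.+1)%N.
Proof.
set s := [seq _ <- _ | _]; set n := (2 ^ j)%N; have n2 : (2 ^ j.+1 = n.*2)%N by rewrite expnS mul2n.
have sP q : q \in s -> [/\ prime q, (n < q)%N & (q <= n.*2)%N].
  by rewrite mem_filter mem_index_iota n2 ltnS => /and3P.
have s_dvd : (\prod_(q <- s) q %| 'C(n.*2, n))%N.
  apply: dvdn_prod_primes; first by rewrite filter_uniq ?iota_uniq.
  apply/allP => q /sP[q_pr nq q2n]; rewrite q_pr /=.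
  have : (q %| (n.*2)`!)%N by rewrite prime_dvd_fact.
  rewrite -(@bin_fact n.*2 n) -addnn ?leq_addr // addnK.
  by rewrite !Euclid_dvdM // !prime_dvd_fact // leqNgt nq /= orbF.
rewrite -(leq_exp2l _ _ (ltnSn 1)) expnM -/n n2 -mul2n expnM.
apply: leq_trans (central_bin_le n); apply: leq_trans (dvdn_leq _ s_dvd); last first.
  by rewrite bin_gt0 -addnn leq_addr.
by apply: leq_exp_size_prod; apply/allP => q /sP[_ /ltnW].
Qed.

Variable R : realType.
Implicit Types N J : nat.

Lemma harmonic_le N : (0 < N)%N -> \sum_(1 <= k < N.+1) (k%:R : R)^-1 <= 1 + ln N%:R.
Proof.
elim: N => // -[|N] IH _; first by rewrite big_nat1 invr1 ln1 addr0.
rewrite big_nat_recr //=; apply: le_trans (lerD (IH _) (lexx _)) _ => //.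
rewrite -addrA lerD2l -lerBrDl.
rewrite -(natr1 N.+1); set a : R := N.+1%:R.
have a_gt0 : 0 < a by rewrite ltr0n.
have a1_gt0 : 0 < a + 1 by lra.
rewrite -ln_div ?posrE // -[leLHS]opprK -[leRHS]opprK lerN2 -lnV ?posrE ?divr_gt0 //.
rewrite invf_div (_ : a / (a + 1) = 1 + - (a + 1)^-1); last by field; lra.
by apply: le_ln1Dx; rewrite ltrN2 invf_lt1 //; lra.
Qed.

Lemma ln2_ge : 1 / 2 <= ln 2 :> R.
Proof.
have /le_ln1Dx : -1 < - (1 / 2) :> R by lra.
by rewrite (_ : 1 + - (1 / 2) = 2^-1) ?lnV ?posrE ?lerN2 //; lra.
Qed.

Lemma sum_primeV_dyadic j : (0 < j)%N ->
  \sum_((2 ^ j).+1 <= q < (2 ^ j.+1).+1 | prime q) (q%:R : R)^-1 <= 2 * (j%:R)^-1.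
Proof.
move=> j_gt0; have := size_primes_dyadic j.
rewrite -big_filter; set s := [seq _ <- _ | _] => hs.
apply: le_trans (_ : \sum_(q <- s) ((2 ^ j)%:R : R)^-1 <= _).
  rewrite !big_seq; apply: ler_sum => q; rewrite mem_filter mem_index_iota => /andP[_ /andP[jq _]].
  by rewrite lef_pV2 ?posrE ?ltr0n ?expn_gt0 // ?ler_nat ?(ltnW jq) //; case: q jq.
rewrite big_const_seq count_predT iter_addr_0 -[leLHS]mulr_natl.
rewrite ler_pdivrMr ?ltr0n ?expn_gt0 // mulrAC ler_pdivlMr ?ltr0n //.
by rewrite -natrM -natrM ler_nat mulnC -expnS.
Qed.

Lemma sum_primeV_le_pow J :
  \sum_(1 <= q < (2 ^ J.+1).+1 | prime q) (q%:R : R)^-1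
    <= 1 + 2 * \sum_(1 <= j < J.+1) (j%:R : R)^-1.
Proof.
elim: J => [|J IH].
  rewrite expn1 big_ltn_cond //= big_ltn_cond //= !big_geq //; lra.
rewrite (@big_cat_nat _ _ _ (2 ^ J.+1).+1) //=; last by rewrite ltnS leq_exp2l.
rewrite [X in _ <= 1 + 2 * X]big_nat_recr //= mulrDr addrA.
by apply: lerD => //; exact: sum_primeV_dyadic.
Qed.

(** A weak form of Mertens' theorem. The j-th dyadic block contributes at most 2/j, which leaves a
    harmonic sum up to [J], and J <= 2 ln N because ln 2 >= 1/2. *)
Lemma sum_primeV_le N : (1 < N)%N ->
  \sum_(1 <= q < N.+1 | prime q) (q%:R : R)^-1 <= 3 + 2 * ln (2 * ln N%:R).
Proof.
move=> N_gt1; set J := trunc_log 2 N.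
have J_gt0 : (0 < J)%N by rewrite trunc_log_gt0.
apply: le_trans (_ : \sum_(1 <= q < (2 ^ J.+1).+1 | prime q) (q%:R : R)^-1 <= _).
  apply: (@ler_sum_nat_inj _ _ _ id) => // n /andP[n1 nN] ->; rewrite andbT n1 ltnS.
  by apply: ltnW; apply: leq_ltn_trans (trunc_log_ltn N _).
apply: le_trans (sum_primeV_le_pow J) _.
have := harmonic_le J_gt0; set h := \sum_(_ <= _ < _) _ => hle.
suff : ln J%:R <= ln (2 * ln N%:R) :> R by lra.
have lnN : ln 2 * J%:R <= ln N%:R :> R.
  rewrite mulrC -ln_powR ler_ln ?posrE ?powR_gt0 ?ltr0n // ?powR_mulrn //; last by lia.
  by rewrite -natrX ler_nat trunc_logP //; lia.
have J0 : 0 < J%:R :> R by rewrite ltr0n.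
have := ln2_ge => l2.
have : 1 / 2 * J%:R <= ln N%:R :> R by apply: le_trans lnN; rewrite ler_pM2r.
by move=> h2; rewrite ler_ln ?posrE //; lra.
Qed.
End PrimeSums.

(** * Smooth numbers *)

(** Since [primes 0] is empty, 0 is smooth for every bound; hence the positivity assumptions
    below. *)
Definition smooth (y m : nat) : bool := all (fun p => p <= y)%N (primes m).

Lemma smoothP y m : (0 < m)%N ->
  reflect (forall p, prime p -> (p %| m)%N -> (p <= y)%N) (smooth y m).
Proof.
move=> m_gt0; apply: (iffP allP) => h p.
  by move=> p_pr pm; apply: h; rewrite mem_primes p_pr m_gt0.
by rewrite mem_primes => /and3P[p_pr _ pm]; exact: h.
Qed.

Lemma smooth_dvd y d m : (0 < m)%N -> (d %| m)%N -> smooth y m -> smooth y d.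
Proof.
move=> m_gt0 dm /(smoothP _ m_gt0) sm.
apply/smoothP => [|p p_pr pd]; first exact: dvdn_gt0 dm.
by apply: sm => //; exact: dvdn_trans dm.
Qed.

Section Rankin.
Variable R : realType.
Implicit Types (s x delta K M : R).

(* Splitting the sum over (y+1)-smooth integers m according to y+1 | m gives
   A_{y+1} <= A_y + (y+1)^-s A_{y+1} when y+1 is prime. *)
Lemma sum_smooth_le s y N : 1 / 2 <= s ->
  \sum_(1 <= m < N.+1 | smooth y m) (m%:R : R) `^ (- s)
  <= expR (4 * \sum_(1 <= q < y.+1 | prime q) (q%:R : R) `^ (- s)).
Proof.
move=> s_ge; elim: y => [|y IH].
  rewrite [X in expR (4 * X)]big_geq // mulr0 expR0.
  apply: le_trans (_ : \sum_(1 <= m < 2 | xpredT m) (m%:R : R) `^ (- s) <= _).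
    apply: (@ler_sum_nat_inj _ _ _ id) => // n /andP[n1 _] sn.
    rewrite n1 andbT ltnS leqNgt; apply/negP => n_gt1.
    have := elimT (smoothP _ n1) sn _ (pdiv_prime n_gt1) (pdiv_dvd n).
    by rewrite leqNgt pdiv_gt0.
  by rewrite big_nat1 powR1.
set A := \sum_(_ <= _ < _ | _) _ in IH; set q := y.+1.
rewrite [X in expR (4 * X)]big_mkcond big_nat_recr //= -big_mkcond /=.
have smooth_pred m : (0 < m)%N -> smooth q m -> ~~ (prime q && (q %| m)%N) -> smooth y m.
  move=> m_gt0 /(smoothP _ m_gt0) sm qm; apply/smoothP => // p p_pr pm.
  have := sm _ p_pr pm; rewrite leq_eqVlt ltnS => /orP[/eqP pq|//].
  by rewrite -pq p_pr pm in qm.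
case: ifP => [q_pr|qNpr]; last first.
  rewrite addr0; apply: le_trans IH.
  apply: (@ler_sum_nat_inj _ _ _ id) => // n /[dup] nN /andP[n1 _] sn.
  by rewrite nN; apply: smooth_pred; rewrite ?qNpr.
set t := (q%:R : R) `^ (- s); set B := \sum_(_ <= _ < _ | _) _.
have t_ge0 : 0 <= t by exact: powR_ge0.
have q_ge2 : 2 <= q%:R :> R by rewrite ler_nat prime_gt1.
(* As (1 - t)(1 + 4t) = 1 + t(3 - 4t), this bound is what allows 1/(1 - t) <= exp(4t). It follows
   from t^2 <= 1/q <= 1/2, which is where s >= 1/2 enters. *)
have t_le : t <= 3 / 4.
  have : t ^+ 2 <= 1 / 2.
    rewrite -powR_mulrn // -powRrM.
    apply: le_trans (_ : (q%:R : R) `^ (- 1) <= _).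
      by rewrite ler_powR; lra.
    by rewrite powR_inv1; [rewrite div1r lef_pV2 ?posrE; lra | lra].
  by rewrite expr2; nra.
have AB : B <= A + t * B.
  rewrite {1}/B (bigID (fun m => q %| m)%N) /= addrC; apply: lerD.
    apply: (@ler_sum_nat_inj _ _ _ id) => // n /[dup] nN /andP[n1 _].
    by move=> /andP[sn qn]; rewrite nN; apply: smooth_pred; rewrite ?(negPf qn) ?andbF.
  apply: le_trans (_ : \sum_(1 <= m < N.+1 | smooth q m && (q %| m)%N)
      t * ((m %/ q)%N%:R : R) `^ (- s) <= _).
    apply: ler_sum => m /andP[_ qm]; rewrite /t -powRM ?ler0n // -natrM.
    by rewrite [(q * _)%N]mulnC divnK.
  rewrite -big_distrr /= ler_wpM2l //.
  apply: (@ler_sum_nat_inj _ _ _ (fun m => m %/ q)%N (fun m => m%:R `^ (- s))) => //.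
  - move=> n /andP[n1 nN] /andP[sn qn].
    rewrite divn_gt0 // (dvdn_leq n1 qn) /= (leq_ltn_trans (leq_div _ _) nN).
    apply: smooth_dvd sn => //; apply/dvdnP; exists q; by rewrite mulnC divnK.
  - move=> n m _ _ /andP[_ qn] /andP[_ qm] nm.
    by rewrite -(divnK qn) nm divnK.
have B_ge0 : 0 <= B by apply: sumr_ge0 => m _; exact: powR_ge0.
rewrite mulrDr expRD.
have e4 := expR_ge1Dx (4 * t).
have et : 1 <= (1 - t) * expR (4 * t).
  apply: le_trans (_ : (1 - t) * (1 + 4 * t) <= _); first by nra.
  by apply: ler_wpM2l => //; lra.
apply: le_trans (_ : A * expR (4 * t) <= _).
  apply: le_trans (_ : B * ((1 - t) * expR (4 * t)) <= _); first by rewrite ler_peMr.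
  by rewrite mulrA ler_wpM2r ?expR_ge0 //; lra.
by rewrite ler_wpM2r ?expR_ge0.
Qed.

(** Rankin's trick: each n = d m <= x is counted with weight (x / (d m))^(1 - delta) >= 1, and m is
    again y-smooth. The sum over m is then controlled by [sum_smooth_le], where q^(-(1 - delta)) =
    q^delta / q <= K / q. *)
Lemma count_smooth_multiples_le y N d x delta K M : (0 < d)%N -> N%:R <= x ->
  0 <= delta <= 1 / 2 -> 0 <= K ->
  (forall q, prime q -> (q <= y)%N -> (q%:R : R) `^ delta <= K) ->
  \sum_(1 <= q < y.+1 | prime q) (q%:R : R)^-1 <= M ->
  ((\sum_(1 <= n < N.+1 | smooth y n && (d %| n)) 1)%N)%:R
    <= (x / d%:R) `^ (1 - delta) * expR (4 * (K * M)).
Proof.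
move=> d_gt0 Nx /andP[delta_ge0 delta_le] K_ge0 qK primeM.
have d0 : 0 < d%:R :> R by rewrite ltr0n.
have x_ge0 : 0 <= x by apply: le_trans Nx; rewrite ler0n.
apply: le_trans (_ : (x / d%:R) `^ (1 - delta) *
   \sum_(1 <= m < N.+1 | smooth y m) (m%:R : R) `^ (- (1 - delta)) <= _); last first.
  apply: ler_wpM2l; first exact: powR_ge0.
  apply: le_trans (sum_smooth_le _ _ _) _; first lra.
  rewrite ler_expR ler_pM2l // .
  apply: le_trans (ler_wpM2l K_ge0 primeM); rewrite big_distrr /=.
  rewrite big_seq_cond [leRHS]big_seq_cond; apply: ler_sum => q; rewrite mem_index_iota ltnS.
  move=> /andP[/andP[q1 qy] q_pr].
  have q0 : 0 < q%:R :> R by rewrite ltr0n.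
  rewrite opprB powRD; last by rewrite (gt_eqF q0) implybT.
  by rewrite powR_inv1 ?ler_wpM2r ?invr_ge0 ?(ltW q0) // qK.
rewrite natr_sum.
apply: le_trans (_ : \sum_(1 <= n < N.+1 | smooth y n && (d %| n)%N)
   (x / d%:R) `^ (1 - delta) * ((n %/ d)%N%:R : R) `^ (- (1 - delta)) <= _).
  rewrite big_seq_cond [leRHS]big_seq_cond; apply: ler_sum => n; rewrite mem_index_iota.
  move=> /andP[/andP[n1 nN] /andP[_ dn]].
  have nd_gt0 : (0 < n %/ d)%N by rewrite divn_gt0 // dvdn_leq.
  have nd0 : 0 < (n %/ d)%N%:R :> R by rewrite ltr0n.
  rewrite powRN -ler_pdivrMr ?invr_gt0 ?powR_gt0 // invrK mul1r.
  apply: ge0_ler_powR; rewrite ?nnegrE ?(ltW nd0) ?divr_ge0 ?(ltW d0) //; first lra.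
  rewrite ler_pdivlMr // -natrM divnK //.
  by apply: le_trans Nx; rewrite ler_nat.
rewrite -big_distrr /= ler_wpM2l ?powR_ge0 //.
apply: (@ler_sum_nat_inj _ _ _ (fun m => m %/ d)%N (fun m => m%:R `^ (- (1 - delta)))).
- move=> n /andP[n1 nN] /andP[sn dn].
  rewrite divn_gt0 // (dvdn_leq n1 dn) /= (leq_ltn_trans (leq_div _ _) nN).
  by apply: smooth_dvd sn => //; apply/dvdnP; exists d; rewrite mulnC divnK.
- by move=> n m _ _ /andP[_ dn] /andP[_ dm] nm; rewrite -(divnK dn) nm divnK.
- by move=> i; exact: powR_ge0.
Qed.
End Rankin.

(** * Sorting by the largest prime factor *)

Lemma linear_le_expR (R : realType) (c A B : R) : 0 < c ->
  exists T, forall t, T <= t -> A * t + B <= expR (c * t).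
Proof.
(* For t >= 1 the left side is at most D t with D = |A| + |B|, while exp(c t) is the square of exp(c
   t / 2) and so at least (c t)^2 / 4. This exceeds D t once c^2 t >= 4 D. *)
move=> c_gt0; exists (1 + 4 * (`|A| + `|B|) / c ^+ 2) => t tT.
have c2 : 0 < c ^+ 2 by rewrite exprn_gt0.
set D := `|A| + `|B| in tT.
have D_ge0 : 0 <= D by rewrite addr_ge0.
have t_ge1 : 1 <= t by apply: le_trans tT; rewrite lerDl divr_ge0 ?(ltW c2) ?mulr_ge0.
have Dt : 4 * D <= c ^+ 2 * t.
  by rewrite (mulrC (c ^+ 2)) -ler_pdivrMr //; lra.
have AB : A * t + B <= D * t.
  rewrite /D mulrDl lerD ?ler_wpM2r ?ler_norm //; first lra.
  by apply: le_trans (ler_norm B) _; rewrite ler_peMr.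
apply: le_trans AB _; rewrite (_ : c * t = c * t / 2 + c * t / 2); last by field.
rewrite expRD; have h := expR_ge1Dx (c * t / 2).
have ct : 0 < c * t / 2 by rewrite divr_gt0 // mulr_gt0 //; lra.
apply: le_trans (_ : (c * t / 2) * (c * t / 2) <= _); last by apply: ler_pM; lra.
rewrite (_ : c * t / 2 * (c * t / 2) = (c ^+ 2 * t) * t / 4); last by field.
nra.
Qed.

(* With delta = a lambda / (2 ln p), the factor x^-delta is
   exp (- a omega^2 / (2 ln p)), which AM-GM bounds by exp (- a omega) sqrt p. *)
Lemma rankin_weight_le (R : realType) (x a p zp : R) :
  let l := ln x in let lam := ln l in let om := Num.sqrt (l * lam) in
  let delta := a * lam / (2 * ln p) in
  0 < x -> 0 <= l -> 0 <= lam -> 0 <= a <= 1 -> 2 <= p -> 1 <= zp <= p + 1 -> delta <= 1 ->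
  (x / (p * zp)) `^ (1 - delta) <=
  x * expR (- (a * om)) * expR (3 / 2 * a * lam) * (expR (- (ln p / 2)) * zp^-1).
Proof.
move=> l lam om delta x_gt0 l_ge0 lam_ge0 /andP[a_ge0 a_le1] p_ge2 /andP[z_ge1 z_le] delta_le1.
have p_gt0 : 0 < p by lra.
have z_gt0 : 0 < zp by lra.
have t_gt0 : 0 < ln p by rewrite ln_gt0 //; lra.
have om2 : om ^+ 2 = l * lam by rewrite sqr_sqrtr // mulr_ge0.
have lnz : ln zp <= 2 * ln p.
  rewrite mulr_natl -lnXn // ler_ln ?posrE ?exprn_gt0 //.
  by apply: le_trans z_le _; rewrite expr2; nra.
have delta_ge0 : 0 <= delta by rewrite divr_ge0 ?mulr_ge0 // ltW.
rewrite -[x / (p * zp)]lnK ?posrE ?divr_gt0 ?mulr_gt0 // -expRM.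
rewrite ln_div ?posrE ?mulr_gt0 // lnM ?posrE // -/l.
rewrite -[X in _ <= X * _ * _ * _](@lnK _ x) ?posrE // -/l.
rewrite -[zp^-1](@lnK _ zp^-1) ?posrE ?invr_gt0 // lnV ?posrE //.
rewrite -!expRD ler_expR.
(* The constant 3/2 collects delta ln p = a lam / 2 and delta ln z <= a lam, the latter because z <=
   p + 1 <= p^2. *)
have dt : delta * ln p = a * lam / 2 by rewrite /delta; field; rewrite gt_eqF.
have dz : delta * ln zp <= a * lam.
  by apply: le_trans (ler_wpM2l delta_ge0 lnz) _; rewrite mulrCA dt; lra.
have dl : a * om - ln p / 2 <= delta * l.
  rewrite -(ler_pM2r t_gt0) (mulrAC delta) (_ : delta * ln p * l = a * om ^+ 2 / 2); last first.
    by rewrite dt om2; field.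
  have h1 : 0 <= a * (om - ln p) ^+ 2 by rewrite mulr_ge0 ?sqr_ge0.
  have h2 : 0 <= (1 - a) * ln p ^+ 2 by rewrite mulr_ge0 ?sqr_ge0 //; lra.
  rewrite !expr2 in h1 h2 *; nra.
nra.
Qed.

Section LargestPrimeFactor.
Variables (R : realType) (S : pred nat) (p0 B : nat) (z : nat -> nat).
(** All that the count uses about ranks: the first fact keeps ln (z p) below 2 ln p, the second
    reduces the sum of 1 / (z p)^2 to a harmonic sum, and the third places [n] among the multiples
    of [p * z p]. *)
Hypothesis z_bounds : forall p, prime p -> (p0 < p)%N -> (0 < z p <= p.+1)%N.
Hypothesis z_fibre : forall k s, (0 < k)%N -> uniq s ->
  all (fun p => [&& prime p, p0 < p & z p == k])%N s -> (size s <= B * k)%N.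
Hypothesis S_dvd : forall p n, prime p -> (p0 < p)%N -> (0 < n)%N -> S n ->
  (p %| n)%N -> (p * z p %| n)%N.

Lemma sum_fibre_le N k : (0 < k)%N ->
  \sum_(1 <= p < N.+1 | [&& prime p, p0 < p & z p == k]%N) (k%:R ^- 2 : R)
  <= B%:R * k%:R^-1.
Proof.
move=> k_gt0; rewrite -big_filter big_const_seq count_predT iter_addr_0.
have k0 : 0 < k%:R :> R by rewrite ltr0n.
set s := [seq _ <- _ | _].
have : (size s <= B * k)%N.
  apply: z_fibre => //; first by rewrite filter_uniq ?iota_uniq.
  exact: filter_all.
move=> ss; rewrite -[leLHS]mulr_natr expr2 invfM -mulrA mulrC ler_pM2r ?invr_gt0 //.
by rewrite ler_pdivrMl // -natrM ler_nat mulnC.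
Qed.

Lemma sum_sqrt_rank_le N :
  \sum_(1 <= p < N.+1 | prime p && (p0 < p)%N)
     expR (- (ln p%:R / 2)) * ((z p)%:R : R)^-1
  <= (1 + B%:R) * \sum_(1 <= k < N.+2) (k%:R : R)^-1.
Proof.
apply: le_trans (_ : \sum_(1 <= p < N.+1 | prime p && (p0 < p)%N)
   ((p%:R : R)^-1 + (z p)%:R ^- 2) <= _).
  apply: ler_sum => p /andP[p_pr _].
  have pp : 0 < p%:R :> R by rewrite ltr0n prime_gt0.
  have -> : (p%:R : R)^-1 = expR (- (ln p%:R / 2)) ^+ 2.
    rewrite -expRM_natl (_ : _ * _ = - ln p%:R); last by field.
    by rewrite expRN lnK ?posrE.
  rewrite -exprVn; set u := expR _; set v := _^-1.
  have := sqr_ge0 (u - v); have := sqr_ge0 u; have := sqr_ge0 v.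
  by rewrite !expr2; nra.
rewrite big_split mulrDl mul1r; apply: lerD.
  apply: (@ler_sum_nat_inj _ _ xpredT id (fun k => k%:R^-1)) => //.
  by move=> n /andP[-> /= /ltnW]; rewrite andbT.
(* The primes are grouped by the value k of [z]; k must reach N + 1 because [z p] can be p + 1. *)
apply: le_trans (_ : \sum_(1 <= p < N.+1 | prime p && (p0 < p)%N)
   \sum_(1 <= k < N.+2) (if z p == k then k%:R ^- 2 : R else 0) <= _).
  rewrite big_seq_cond [leRHS]big_seq_cond; apply: ler_sum => p.
  rewrite mem_index_iota => /and3P[/andP[_ pN] p_pr pp0].
  have /andP[z1 zp] := z_bounds p_pr pp0.
  rewrite (bigD1_seq (z p)) ?iota_uniq //=; last first.
    by rewrite mem_index_iota z1 ltnS (leq_trans zp).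
  rewrite eqxx lerDl; apply: sumr_ge0 => k _; case: ifP => // _.
rewrite exchange_big /= big_distrr /= !big_seq; apply: ler_sum => k.
rewrite mem_index_iota => /andP[k_gt0 _]; rewrite -big_mkcondr /=.
apply: le_trans (sum_fibre_le N k_gt0).
by rewrite le_eqVlt; apply/orP; left; apply/eqP; apply: eq_bigl => p; rewrite andbA.
Qed.

(* The condition [1 %| n] gives both sums the shape of
   [count_smooth_multiples_le]. *)
Lemma count_split N y0 : (p0 <= y0)%N ->
  (\sum_(1 <= n < N.+1 | S n) 1 <=
   \sum_(1 <= n < N.+1 | smooth y0 n && (1 %| n)) 1 +
   \sum_(1 <= p < N.+1 | prime p && (y0 < p))
      \sum_(1 <= n < N.+1 | smooth p n && (p * z p %| n)) 1)%N.
Proof.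
move=> p0y0.
pose G p n := (if smooth p n && (p * z p %| n) then 1 else 0)%N.
apply: leq_trans (_ : \sum_(1 <= n < N.+1)
   ((if smooth y0 n && (1 %| n) then 1 else 0) +
     \sum_(1 <= p < N.+1 | prime p && (y0 < p)) G p n) <= _)%N; last first.
  rewrite big_split /= -big_mkcond leq_add2l exchange_big /=.
  by apply: leq_sum => p _; rewrite -big_mkcond.
rewrite big_mkcond big_seq [leqRHS]big_seq; apply: leq_sum => n.
rewrite mem_index_iota ltnS dvd1n andbT => /andP[n_gt0 nN].
case: ifP => // Sn; case: ifP => [_|sn]; first by rewrite add1n.
(* The index 1 is smooth, so here the largest prime factor exists; its term in the sum over p
   catches [n]. *)
have n_gt1 : (1 < n)%N.
  rewrite ltn_neqAle n_gt0 andbT; apply: contraFN sn => /eqP <-.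
  by apply/smoothP => // p p_pr; rewrite dvdn1 => /eqP p1; rewrite p1 in p_pr.
have p_pr := max_pdiv_prime n_gt1; have pn := max_pdiv_dvd n.
set p := max_pdiv n in p_pr pn.
have sp : smooth p n.
  apply/smoothP => // q q_pr qn; apply: max_pdiv_max.
  by rewrite mem_primes q_pr n_gt0.
have y0p : (y0 < p)%N.
  rewrite ltnNge; apply: contraFN sn => py.
  by apply: sub_all sp => q /leq_trans; apply.
have pN : (p <= N)%N by apply: leq_trans nN; exact: dvdn_leq.
rewrite add0n big_mkcond (bigD1_seq p) ?iota_uniq //=; last first.
  by rewrite mem_index_iota prime_gt0.
by rewrite p_pr y0p /G sp (S_dvd p_pr (leq_ltn_trans p0y0 y0p) n_gt0 Sn pn).
Qed.

(** The cut is at y0 = exp(om / 2) rounded down. Up to it a single delta = a lam / om serves; beyond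
    it delta = a lam / (2 ln p) depends on p. In both ranges delta <= 1/2, as [sum_smooth_le]
    requires, because ln p >= om / 2 beyond the cut and 2 lam <= om. *)
Lemma count_le (x a : R) :
  let l := ln x in let lam := ln l in let om := Num.sqrt (l * lam) in
  0 <= a <= 1 -> 1 <= lam -> 2 * lam <= om -> p0.+1%:R <= expR (om / 2) ->
  ((\sum_(1 <= n < (Num.truncn x).+1 | S n) 1)%N)%:R <=
  x * expR (- (a * om)) * expR (4 * (expR (a * lam / 2) * (5 + 2 * lam)))
    * expR (3 / 2 * a * lam) * (1 + (1 + B%:R) * (2 + l)).
Proof.
move=> l lam om a01 lam_ge1 lam_om p0_om; have /andP[a_ge0 a_le1] := a01.
have l_gt0 : 0 < l by rewrite ltNge; apply/negP => /ln0 l0; move: lam_ge1; rewrite /lam l0; lra.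
have lE : expR lam = l by rewrite lnK.
have l_ge : 1 + lam <= l by rewrite -lE expR_ge1Dx.
have x_gt0 : 0 < x by rewrite ltNge; apply/negP => /ln0 x0; move: l_gt0; rewrite /l x0; lra.
have xE : expR l = x by rewrite lnK.
have x_ge : 1 + l <= x by rewrite -xE expR_ge1Dx.
have om2 : om ^+ 2 = l * lam by rewrite sqr_sqrtr // mulr_ge0; lra.
have om_gt0 : 0 < om by lra.
have om_le : om <= l.
  by rewrite -ler_sqr ?nnegrE ?(ltW om_gt0) ?(ltW l_gt0) // om2 expr2 ler_pM2l //; lra.
set N := Num.truncn x; set y0 := Num.truncn (expR (om / 2)).
have Nx : N%:R <= x by rewrite truncn_le ltW.
have N_ge2 : (2 <= N)%N by rewrite truncn_ge_nat //; lra.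
have y0N : (y0 <= N)%N by apply: le_truncn; rewrite -xE ler_expR; lra.
have p0y0 : (p0 < y0)%N by rewrite truncn_ge_nat ?(ltW (expR_gt0 _)).
have y0_om q : (q <= y0)%N -> q%:R <= expR (om / 2).
  by move=> qy; apply: le_trans (_ : y0%:R <= _); rewrite ?ler_nat // truncn_le ltW ?expR_gt0.
have om_y0 q : (y0 < q)%N -> om / 2 <= ln q%:R.
  move=> y0q; rewrite -[leLHS]expRK ler_ln ?posrE ?expR_gt0 ?ltr0n ?(leq_ltn_trans _ y0q) //.
  by apply: le_trans (ltW (truncnS_gt _)) _; rewrite ler_nat.
(* [M] bounds 3 + 2 ln (2 ln N) from [sum_primeV_le], using ln 2 <= 1. [K] is p^delta for a large
   prime p, and exp(om / 2)^delta in the smooth part. *)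
set M := 5 + 2 * lam; set K := expR (a * lam / 2).
have lnN_gt0 : 0 < ln N%:R :> R by rewrite ln_gt0 // ltr1n.
have lnN_le : ln N%:R <= l by rewrite ler_ln ?posrE ?ltr0n ?(ltnW N_ge2).
have NM y : (y <= N)%N -> \sum_(1 <= q < y.+1 | prime q) (q%:R : R)^-1 <= M.
  move=> yN; apply: le_trans (_ : \sum_(1 <= q < N.+1 | prime q) (q%:R : R)^-1 <= _).
    apply: (@ler_sum_nat_inj _ _ _ id) => // n /andP[n1 nN] ->.
    by rewrite n1 /= andbT (leq_trans nN).
  apply: le_trans (sum_primeV_le _ N_ge2) _.
  rewrite lnM ?posrE //.
  have : ln (ln N%:R) <= lam by rewrite ler_ln ?posrE.
  have := @le_ln1Dx R 1; rewrite /M; lra.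
have K_ge0 : 0 <= K by exact: expR_ge0.
have KM_ge0 : 0 <= 4 * (K * M) by rewrite !mulr_ge0 // /M; lra.
have powK (q : nat) t delta : (0 < q)%N -> ln q%:R <= t -> 0 <= delta -> delta * t = a * lam / 2 ->
    (q%:R : R) `^ delta <= K.
  move=> q_gt0 qt d_ge0 dt; rewrite -[q%:R]lnK ?posrE ?ltr0n // -expRM ler_expR.
  by rewrite mulrC -dt ler_wpM2l.
set E := expR (4 * (K * M)); set E' := expR (3 / 2 * a * lam).
have E_ge0 : 0 <= E by exact: expR_ge0.
have E'_ge1 : 1 <= E' by rewrite -expR0 ler_expR !mulr_ge0 //; lra.
have smooth_part : ((\sum_(1 <= n < N.+1 | smooth y0 n && (1 %| n)) 1)%N)%:R <=
    x * expR (- (a * om)) * E.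
  (* With this choice x^(- delta) is exactly exp(- a om), since om^2 = l lam. *)
  pose delta := a * lam / om.
  have d_ge0 : 0 <= delta by rewrite divr_ge0 ?mulr_ge0 //; lra.
  have d_le : delta <= 1 / 2 by rewrite ler_pdivrMr //; nra.
  have := @count_smooth_multiples_le R y0 N 1 x delta K M isT Nx.
  rewrite d_ge0 d_le => /(_ isT K_ge0) h.
  apply: le_trans (h _ (NM _ y0N)) _ => [q q_pr qy|].
    apply: (@powK q (om / 2)); rewrite ?prime_gt0 //; last by rewrite /delta; field; rewrite gt_eqF.
    by rewrite -[leRHS]expRK ler_ln ?posrE ?expR_gt0 ?ltr0n ?prime_gt0 // y0_om.
  rewrite ler_wpM2r // divr1 -[X in X `^ _]xE -expRM -[X in _ <= X * _]xE -expRD ler_expR.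
  rewrite mulrBr mulr1 lerD2l lerN2 le_eqVlt; apply/orP; left; apply/eqP.
  apply: (mulIf (lt0r_neq0 om_gt0)); rewrite -mulrA -[om * om]expr2 om2 /delta.
  by field; rewrite gt_eqF.
have large_part p : prime p -> (y0 < p)%N -> (p < N.+1)%N ->
    ((\sum_(1 <= n < N.+1 | smooth p n && (p * z p %| n)) 1)%N)%:R <=
    x * expR (- (a * om)) * E * E' * (expR (- (ln p%:R / 2)) * ((z p)%:R)^-1).
  move=> p_pr y0p pN; have p_gt0 := prime_gt0 p_pr.
  have /andP[z_gt0 z_le] := z_bounds p_pr (leq_trans p0y0 (ltnW y0p)).
  have lnp := om_y0 p y0p; have lnp_gt0 : 0 < ln p%:R :> R by lra.
  pose delta : R := a * lam / (2 * ln p%:R).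
  have d_ge0 : 0 <= delta by rewrite divr_ge0 ?mulr_ge0 //; lra.
  have d_le : delta <= 1 / 2 by rewrite ler_pdivrMr; nra.
  have pz_gt0 : (0 < p * z p)%N by rewrite muln_gt0 p_gt0.
  have := @count_smooth_multiples_le R p N (p * z p) x delta K M pz_gt0 Nx.
  rewrite d_ge0 d_le => /(_ isT K_ge0) h.
  apply: le_trans (h _ (NM _ pN)) _ => [q q_pr qp|].
    apply: (@powK q (ln p%:R)); rewrite ?prime_gt0 //; last first.
      by rewrite /delta; field; rewrite gt_eqF.
    by rewrite ler_ln ?posrE ?ltr0n ?prime_gt0 // ler_nat.
  rewrite (mulrAC _ E) (mulrAC _ E) ler_wpM2r // natrM.
  apply: rankin_weight_le => //; first exact: ltW.
  - exact: le_trans ler01 lam_ge1.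
  - by rewrite ler_nat prime_gt1.
  - by rewrite natr1 ler_nat ler1n z_gt0.
  - by apply: le_trans d_le _; lra.
apply: le_trans (_ : _ <= x * expR (- (a * om)) * E +
  x * expR (- (a * om)) * E * E' * ((1 + B%:R) * (2 + l))) _; last first.
  rewrite [leRHS]mulrDr mulr1 lerD2r ler_peMr // !mulr_ge0 ?expR_ge0 //; lra.
apply: le_trans (_ : _ <= (_ + _)%N%:R) _.
  by rewrite ler_nat; apply: count_split (ltnW p0y0).
rewrite natrD; apply: lerD => //; rewrite natr_sum.
apply: le_trans (_ : \sum_(1 <= p < N.+1 | prime p && (p0 < p)%N)
   x * expR (- (a * om)) * E * E' * (expR (- (ln p%:R / 2)) * ((z p)%:R)^-1) <= _).
  rewrite big_mkcond [leRHS]big_mkcond big_seq [leRHS]big_seq.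
  apply: ler_sum => p; rewrite mem_index_iota => /andP[p_gt0 pN].
  case: ifP => [/andP[p_pr y0p]|_]; first by rewrite p_pr (ltn_trans p0y0 y0p) large_part.
  by case: ifP => // _; rewrite !mulr_ge0 ?expR_ge0 //; lra.
rewrite -big_distrr /= ler_wpM2l //; first by rewrite !mulr_ge0 ?expR_ge0 //; lra.
apply: le_trans (sum_sqrt_rank_le N) _; rewrite ler_wpM2l ?addr_ge0 //.
(* The harmonic sum runs to N + 1; its last term is at most 1, which turns 1 + l into 2 + l. *)
rewrite big_nat_recr //= (_ : 2 + l = 1 + l + 1); last by ring.
apply: lerD; last by rewrite invf_le1 ?ltr0n // ler1n.
by apply: le_trans (@harmonic_le R N (ltnW N_ge2)) _; rewrite lerD2l lnN_le.
Qed.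

(** The loss [eps] is split as 3 eta. Taking a = 1 - 2 eta makes exp(a lam / 2) smaller than exp(lam
    / 2) <= om by the factor exp(eta lam), which beats the linear factor 5 + 2 lam. The remaining
    eta om is shared equally by this error ([t1]) and by the terms of order lam ([t2]). *)
Lemma count_eventually_le (eps : R) : 0 < eps -> exists X, forall x, X <= x ->
  1 <= ln (ln x) /\
  ((\sum_(1 <= n < (Num.truncn x).+1 | S n) 1)%N)%:R <=
  x * expR (- ((1 - eps) * Num.sqrt (ln x * ln (ln x)))).
Proof.
(* For eps > 1 the bound with 1 in place of [eps] is stronger; eps <= 1 keeps [a] nonnegative. *)
wlog eps_lt1 : eps / eps <= 1.
  move=> H eps_gt0; have [/H/(_ eps_gt0)//|eps_ge1] := leP eps 1.
  have [X hX] := H 1 (lexx _) ltr01; exists (Num.max X 0) => x.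
  rewrite ge_max => /andP[/hX[h1 h2] x0].
  split=> //; apply: le_trans h2 _; rewrite ler_wpM2l // ler_expR lerN2.
  rewrite ler_wpM2r ?sqrtr_ge0 //; lra.
move=> eps_gt0; pose eta := eps / 3; pose a := 1 - 2 * eta.
have eta_gt0 : 0 < eta by rewrite divr_gt0.
have a01 : 0 <= a <= 1 by rewrite /a /eta; lra.
have /andP[a_ge0 a_le1] := a01.
have half : 0 < 1 / 2 :> R by lra.
(* [T1] and [T2] serve the error bounds [t1] and [t2]. [T3] and [T4] serve the hypotheses of
   [count_le]: 2 lam <= om, and p0 <= om / 2, whence p0 + 1 <= exp(om / 2). *)
have [T1 hT1] := @linear_le_expR R eta (16 / eta) (40 / eta) eta_gt0.
have [T2 hT2] := @linear_le_expR R (1 / 2) (5 / eta) (2 * ln (4 + 3 * B%:R) / eta) half.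
have [T3 hT3] := @linear_le_expR R (1 / 2) 2 0 half.
have [T4 hT4] := @linear_le_expR R (1 / 2) 0 (2 * p0%:R) half.
pose T := Num.max 1 (Num.max T1 (Num.max T2 (Num.max T3 T4))).
exists (expR (expR T)) => x xT.
have x_gt0 : 0 < x by apply: lt_le_trans xT; exact: expR_gt0.
have lT : expR T <= ln x by rewrite -[leLHS]expRK ler_ln ?posrE ?expR_gt0.
have l_gt0 : 0 < ln x by apply: lt_le_trans lT; exact: expR_gt0.
have : T <= ln (ln x) by rewrite -[leLHS]expRK ler_ln ?posrE ?expR_gt0.
set l := ln x in lT l_gt0 *; set lam := ln l; set om := Num.sqrt (l * lam).
rewrite !ge_max => /and5P[lam_ge1 /hT1 h1 /hT2 h2 /hT3 h3 /hT4 h4].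
split=> //.
have lE : expR lam = l by rewrite lnK.
have l_ge1 : 1 <= l by rewrite -lE -expR0 ler_expR; lra.
have om_ge : expR (1 / 2 * lam) <= om.
  rewrite -ler_sqr ?nnegrE ?expR_ge0 ?sqrtr_ge0 // sqr_sqrtr ?mulr_ge0 //; try lra.
  rewrite -expRM_natl (_ : _ * _ = lam); last by field.
  by rewrite lE ler_peMr // ltW.
apply: le_trans (@count_le x a a01 lam_ge1 _ _) _; rewrite -/l -/lam -/om; first lra.
  have := expR_ge1Dx (om / 2); rewrite -(natr1 p0); lra.
(* As l >= 1, the left side is at most (4 + 3 B) l. *)
have Y_le : 1 + (1 + B%:R) * (2 + l) <= expR (lam + ln (4 + 3 * B%:R)).
  have B_ge0 : 0 <= B%:R :> R by exact: ler0n.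
  by rewrite expRD lE lnK ?posrE; nra.
apply: le_trans (ler_wpM2l _ Y_le) _; first by rewrite !mulr_ge0 ?expR_ge0 // ltW.
rewrite -!(mulrA x) ler_wpM2l ?(ltW x_gt0) //.
rewrite -!expRD ler_expR.
have aE : a * lam / 2 = 1 / 2 * lam - eta * lam by rewrite /a; field.
have t1 : 4 * (expR (a * lam / 2) * (5 + 2 * lam)) <= eta / 2 * om.
  rewrite aE expRB; apply: le_trans (_ : eta / 2 * expR (1 / 2 * lam) <= _); last first.
    by rewrite ler_wpM2l //; lra.
  rewrite mulrA (mulrA 4) [leLHS]mulrAC ler_pdivrMr ?expR_gt0 // (mulrC 4) -(mulrA (expR _)).
  rewrite (mulrC (eta / 2)) -[leRHS]mulrA ler_wpM2l ?expR_ge0 //.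
  rewrite (_ : 4 * (5 + 2 * lam) = eta / 2 * (16 / eta * lam + 40 / eta)).
    by rewrite ler_wpM2l //; lra.
  by field; rewrite gt_eqF.
have t2 : 5 / 2 * lam + ln (4 + 3 * B%:R) <= eta / 2 * om.
  rewrite (_ : 5 / 2 * lam + ln (4 + 3 * B%:R) =
    eta / 2 * (5 / eta * lam + 2 * ln (4 + 3 * B%:R) / eta)).
    by rewrite ler_wpM2l //; lra.
  by field; rewrite gt_eqF.
have t3 : a * lam <= lam by rewrite ler_piMl //; lra.
have -> : eps = 3 * eta by rewrite /eta; field.
rewrite /a in t1 t3 *; nra.
Qed.
End LargestPrimeFactor.

(** * From a bound for each epsilon to a single o(1) *)

Lemma ndvdz_large p (m : int) : m != 0 -> (`|m| < p)%N -> ~~ (p %| m)%Z.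
Proof.
move=> m0 mp; apply/negP => /(@dvdn_leq p `|m|%N); rewrite absz_gt0 => /(_ m0).
by rewrite leqNgt mp.
Qed.

(** Neither truncation is active here: [ln x < 1] would make [ln (ln x)] nonpositive. *)
Lemma L_eq_expR (R : realType) (x : R) : 1 <= ln (ln x) ->
  L x = expR (Num.sqrt (ln x * ln (ln x))).
Proof.
move=> h; have l_ge1 : 1 <= ln x.
  rewrite leNgt; apply/negP => l1.
  by have := ln_le0 (ltW l1); lra.
by rewrite /L /log_trunc (max_l l_ge1) (max_l h).
Qed.

Theorem theorem2 (R : realType) (a1 a2 : int) (alpha1 alpha2 : algC)
    (a2_neq0 : a2 != 0)
    (a1a2_coprime : gcdz a1 a2 = 1)
    (alpha_roots : lucas_charpoly a1 a2 = ('X - alpha1%:P) * ('X - alpha2%:P))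
    (alpha_distinct : alpha1 != alpha2)
    (alpha_nondegenerate :
      forall m : nat, (0 < m)%N -> ~~ (m.-unity_root (alpha1 / alpha2))) :
  exists eps : R -> R,
    eps x @[x --> +oo] --> (0 : R) /\
    \forall x \near +oo,
      (count_dvd_lucas a1 a2 x)%:R <= x / (L x `^ (1 + eps x)).
Proof.
(* A prime above [p0] is odd and divides neither [a2] nor the discriminant [D], as [lucas_rank]
   requires. *)
pose D := a1 ^+ 2 + 4 * a2; pose p0 := (2 + (`|a2| + `|D|))%N.
have D_neq0 : D != 0 := lucas_disc_neq0 alpha_roots alpha_distinct.
(* The existential precedes the conditions on [p] so that [choice] yields a function on all of
   nat. *)
have rankP p : exists z, prime p -> (p0 < p)%N ->
    [/\ (0 < z <= p.+1)%N, (p %| lucas a1 a2 z)%Z &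
      forall n, (p %| lucas a1 a2 n)%Z -> (p %| n)%N -> (p * z %| n)%N].
  have [/andP[p_pr p0p]|h] := boolP (prime p && (p0 < p)%N); last first.
    by exists 0%N => p_pr p0p; rewrite p_pr p0p in h.
  have [|||z zP] := @lucas_rank a1 a2 p p_pr.
  - by apply: leq_ltn_trans p0p; exact: leq_addr.
  - apply: ndvdz_large => //; apply: leq_ltn_trans p0p.
    by rewrite /p0 addnCA leq_addr.
  - apply: ndvdz_large => //; apply: leq_ltn_trans p0p.
    by rewrite /p0 addnA leq_addl.
  by exists z.
have [z zP] := choice rankP.
pose S n := (n%:Z %| lucas a1 a2 n)%Z.
have count_le := @count_eventually_le R S p0 (`|a1| + `|a2|) z.
have {}count_le := count_le (fun p p_pr p0p => let: And3 h _ _ := zP p p_pr p0p in h).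
have {}count_le : forall e : R, 0 < e -> exists X, forall x, X <= x -> 1 <= ln (ln x) /\
    (count_dvd_lucas a1 a2 x)%:R <= x * expR (- ((1 - e) * ln (L x))).
  move=> e e_gt0; have [||X hX] := count_le _ _ e e_gt0.
  - move=> k s k_gt0 us sP.
    apply: (lucas_prime_divisors_le a2_neq0 alpha_roots alpha_distinct k_gt0) => //.
      exact: alpha_nondegenerate.
    apply: sub_all sP => p /and3P[p_pr p0p /eqP <-]; rewrite p_pr /=.
    by have [] := zP p p_pr p0p.
  - move=> p n p_pr p0p n_gt0 Sn pn; have [_ _ h] := zP p p_pr p0p.
    by apply: h => //; apply: dvdz_trans Sn.
  by exists X => x /hX[l1 h]; split; rewrite // L_eq_expR // expRK.
pose c (x : R) : R := (count_dvd_lucas a1 a2 x)%:R.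
(* The second argument is the v with x / c x = L(x)^(1 + v). The minimum with 0 bounds [eps] above,
   so that convergence needs only a lower bound on v. *)
pose eps x := Num.min 0 (ln (x / c x) / ln (L x) - 1).
have [X0 hX0] := count_le 1 ltr01.
have large x : Num.max X0 1 <= x -> [/\ 0 < x / c x, 0 < ln (L x) & 1 <= ln (ln x)].
  rewrite ge_max => /andP[/hX0[l1 _] x1]; split=> //; last first.
    rewrite L_eq_expR // expRK sqrtr_gt0 mulr_gt0 //; last by lra.
    by rewrite ltNge; apply/negP => /ln0 l0; move: l1; rewrite l0 ler10.
  have x_gt0 : 0 < x by lra.
  (* The index 1 is always counted, so the count is positive. *)
  rewrite divr_gt0 // /c ltr0n /count_dvd_lucas big_ltn_cond; last first.
    by rewrite ltnS truncn_gt0.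
  by rewrite dvd1z add1n.
exists eps; split.
  apply/cvgr0Pnorm_lt => e e_gt0.
  have e2_gt0 : 0 < e / 2 by rewrite divr_gt0.
  have [X hX] := count_le _ e2_gt0.
  near=> x.
  have [xc_gt0 L_gt0 _] : [/\ 0 < x / c x, 0 < ln (L x) & 1 <= ln (ln x)].
    by apply: large; near: x; apply: nbhs_pinfty_ge; exact: num_real.
  have [_ hc] : 1 <= ln (ln x) /\ c x <= x * expR (- ((1 - e / 2) * ln (L x))).
    by apply: hX; near: x; apply: nbhs_pinfty_ge; exact: num_real.
  have : - (e / 2) <= ln (x / c x) / ln (L x) - 1.
    rewrite lerBrDl ler_pdivlMr // -[leLHS]expRK ler_ln ?posrE ?expR_gt0 //.
    have x_gt0 : 0 < x.
      by apply: lt_le_trans ltr01 _; near: x; apply: nbhs_pinfty_ge; exact: num_real.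
    have c_gt0 : 0 < c x by move: xc_gt0; rewrite pmulr_rgt0 // invr_gt0.
    rewrite ler_pdivlMr // mulrC -ler_pdivlMr ?expR_gt0 // -expRN.
    exact: hc.
  rewrite /eps; set u := _ - 1 => u_ge.
  rewrite ler0_norm ?ge_min ?lexx // ltrNl lt_min; apply/andP; split; lra.
near=> x.
have [xc_gt0 L_gt0 _] : [/\ 0 < x / c x, 0 < ln (L x) & 1 <= ln (ln x)].
  by apply: large; near: x; apply: nbhs_pinfty_ge; exact: num_real.
have x_gt0 : 0 < x by apply: lt_le_trans ltr01 _; near: x; apply: nbhs_pinfty_ge; exact: num_real.
have c_gt0 : 0 < c x by move: xc_gt0; rewrite pmulr_rgt0 // invr_gt0.
have Lx_gt0 : 0 < L x by exact: expR_gt0.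
rewrite -/(c x) ler_pdivlMr ?powR_gt0 // mulrC -ler_pdivlMr //.
rewrite -ler_ln ?posrE ?powR_gt0 // ln_powR -ler_pdivlMr //.
by rewrite -lerBrDl /eps ge_min lexx orbT.
Unshelve. all: by end_near.
Qed.
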